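(* Let $w$ be an infinite word generated by a morphism $\phi$ with $\det A_\phi\ne\pm1$. If $w$ contains a cutting factor, then $w$ does not satisfy the WELLDOC property.
   Context: Alphabet $\Sigma=\{0,\dots,\sigma-1\}$. A morphism is nonerasing; $w$ is generated by $\phi$ if $\phi(a)=as$ with $s$ nonempty and $w=\lim_n\phi^n(a)$, so $w=\phi(w)$. $A_\phi$ is the $\sigma\times\sigma$ matrix with entry $|\phi(i)|_j$ in row $j$, column $i$. Define $f_w(0)=0$ and $f_w(i)=|\phi(w[0,i))|$ for $i>0$; the numbers $f_w(i)$ are called cutting points (so $w$ is the concatenation of blocks $w[f_w(i),f_w(i+1))=\phi(w_i)$). A factor $u$ of $w$ is cutting if there is an integer $k$ such that for every occurrence of $u$ in $w$ at a position $m$, the index $m+k$ is a cutting point. Parikh vector $V_u=(|u|_0,\dots,|u|_{\sigma-1})$; for a factor $u$ occurring at positions $a_0<a_1<\dots$, $X_u=\{V_{w[0,a_i)}\}$, $X_{u,m}$ its reduction mod $m$; WELLDOC means $X_{u,m}=(\mathbb{Z}/m\mathbb{Z})^\sigma$ for all $m\ge1$ and all factors $u$. *)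

(* Defs.v *)
From HB Require Import structures.
From mathcomp Require Import all_boot all_order all_algebra.

Set Implicit Arguments.
Unset Strict Implicit.
Unset Printing Implicit Defensive.

Import GRing.Theory Num.Theory.

Section Words.

Variable sigma : nat.

Notation letter := 'I_sigma.
Notation word := (seq 'I_sigma).

Implicit Types (phi : letter -> word) (w : nat -> letter) (u : word).

(* A morphism of the free monoid, given by its images of letters. *)
Definition extend phi u : word := flatten (map phi u).

Definition nonerasing phi : Prop := forall a : letter, phi a <> [::].

(* w[i, i + n) *)
Definition slice w (i n : nat) : word := map w (iota i n).

(* Convergence of a sequence of finite words to an infinite word: every prefix
   of w is eventually a prefix of x n. *)
Definition converges_to (x : nat -> word) w : Prop :=
  forall l, exists N, forall n, N <= n -> prefix (slice w 0 l) (x n).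

Definition generated_by phi w : Prop :=
  exists (a : letter) (s : word),
    [/\ phi a = a :: s, s <> [::] &
        converges_to (fun n => iter n (extend phi) [:: a]) w].

Definition incidence_matrix phi : 'M[int]_sigma :=
  \matrix_(j < sigma, i < sigma) (Posz (count_mem j (phi i))).

Definition occurs_at w u (m : nat) : Prop := slice w m (size u) = u.

Definition factor w u : Prop := exists m, occurs_at w u m.

Definition cut phi w (i : nat) : nat := size (extend phi (slice w 0 i)).

(* Points are integers since the offset k below may be negative. *)
Definition cutting_point phi w (x : int) : Prop :=
  exists i : nat, x = Posz (cut phi w i).

Definition cutting phi w u : Prop :=
  factor w u /\
  exists k : int, forall m : nat,
    occurs_at w u m -> cutting_point phi w (Posz m + k)%R.

Definition parikh u : 'cV[nat]_sigma := \col_(j < sigma) count_mem j u.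

Definition parikh_prefixes w u (V : 'cV[nat]_sigma) : Prop :=
  exists2 m, occurs_at w u m & V = parikh (slice w 0 m).

(* For m >= 1, Z/mZ is represented by its residues 'I_m; unlike 'Z_m, this is
   also correct at m = 1. *)
Definition parikh_prefixes_mod w u (m : nat) (x : 'cV['I_m]_sigma) : Prop :=
  exists2 V, parikh_prefixes w u V &
    forall j, x j ord0 = V j ord0 %% m :> nat.

Definition welldoc w : Prop :=
  forall (m : nat) u, 1 <= m -> factor w u ->
    forall x : 'cV['I_m]_sigma, parikh_prefixes_mod w u x.

End Words.

(* Main.v *)
Require Import Defs.
From mathcomp Require Import all_boot all_order all_algebra.
From mathcomp Require Import zify.

(** Some prime [p] divides [\det A], so a nonzero row vector [v] over [F_p] is
    killed by [A].  Since [w = phi w], the prefix of [w] ending at a cutting point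
    has Parikh vector in the image of [A], hence annihilated by [v].  Extending a
    cutting factor inside [w] until it reaches its cutting point, one gets a factor
    at whose occurrences [v] takes a constant value on Parikh vectors mod [p], so
    these do not fill [(Z/pZ)^sigma]. *)

Set Implicit Arguments.
Unset Strict Implicit.
Unset Printing Implicit Defensive.

Import GRing.Theory Num.Theory.

Section Words.

Variable sigma : nat.

Implicit Types (phi : 'I_sigma -> seq 'I_sigma) (w : nat -> 'I_sigma).
Implicit Types (u s t : seq 'I_sigma).

Lemma size_slice w i n : size (slice w i n) = n.
Proof. by rewrite size_map size_iota. Qed.

Lemma slice_cat w i m n : slice w i (m + n) = slice w i m ++ slice w (i + m) n.
Proof. by rewrite /slice iotaD map_cat. Qed.

Lemma slice_slice w i n m k l :
  slice w i n = slice w m n -> k + l <= n -> slice w (i + k) l = slice w (m + k) l.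
Proof.
move=> + le_n; rewrite -(subnKC le_n) !slice_cat -!catA => /eqP.
rewrite eqseq_cat ?size_slice // => /andP[_].
by rewrite eqseq_cat ?size_slice // => /andP[/eqP].
Qed.

Lemma extend_cat phi s t : extend phi (s ++ t) = extend phi s ++ extend phi t.
Proof. by rewrite /extend map_cat flatten_cat. Qed.

(** If [slice w 0 i] is a prefix of the [n]-th iterate, its image is a prefix of the next one; for
    large [n] so is the prefix of [w] of the same length. *)
Lemma generated_by_fixed phi w i :
  generated_by phi w -> slice w 0 (cut phi w i) = extend phi (slice w 0 i).
Proof.
move=> [a [_ [_ _ cvg_w]]].
have [N1 H1] := cvg_w i; have [N2 H2] := cvg_w (cut phi w i).
have := H2 (maxn N1 N2).+1 (leqW (leq_maxr _ _)).
have /prefixP[t def_t] := H1 (maxn N1 N2) (leq_maxl _ _).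
by rewrite iterS def_t extend_cat prefixE size_slice take_size_cat // => /eqP.
Qed.

Section ParikhRing.

Local Open Scope ring_scope.

Variable R : comNzRingType.

Definition parikh_ring s : 'cV[R]_sigma := \col_j (count_mem j s)%:R.

Lemma parikh_ring_cat s t : parikh_ring (s ++ t) = parikh_ring s + parikh_ring t.
Proof. by apply/colP=> j; rewrite !mxE count_cat natrD. Qed.

Lemma parikh_ring_extend phi s :
  parikh_ring (extend phi s)
  = map_mx intr (incidence_matrix phi) *m parikh_ring s.
Proof.
elim: s => [|a s IHs].
  have -> : parikh_ring [::] = 0 by apply/colP=> j; rewrite !mxE.
  by rewrite mulmx0; apply/colP=> j; rewrite !mxE.
rewrite -[a :: s]cat1s extend_cat !parikh_ring_cat mulmxDr IHs; congr (_ + _).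
(* For a single letter [a], the product selects column [a] of the matrix, the Parikh vector of
   [phi a]. *)
apply/colP=> j; rewrite !mxE (bigD1 a) //= big1 => [|i ne_ia].
  by rewrite !mxE /= eqxx mulr1 addr0.
by rewrite !mxE /= eq_sym (negPf ne_ia) mulr0.
Qed.

End ParikhRing.

Lemma welldoc_Fp w u p (y : 'cV['F_p]_sigma) :
  prime p -> welldoc w -> factor w u ->
  exists2 n, occurs_at w u n & parikh_ring _ (slice w 0 n) = y.
Proof.
move=> p_pr wd_w fac_u; have p_gt0 := prime_gt0 p_pr.
(* ['I_p] and ['F_p] are different types even for prime [p], so residues are transferred
   entrywise. *)
pose x : 'cV['I_p]_sigma := (\col_j Ordinal (ltn_pmod (y j ord0) p_gt0))%R.
have [_ [n occ_n ->] x_mod] := wd_w p u p_gt0 fac_u x.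
exists n => //; apply/colP=> j; rewrite !mxE.
move: (x_mod j); rewrite !mxE /= => eq_mod.
by rewrite -Fp_nat_mod // -eq_mod Fp_nat_mod // natr_Zp.
Qed.

Lemma cutting_extend phi w u :
  cutting phi w u ->
  exists u' k, [/\ factor w u', k <= size u' &
    forall n, occurs_at w u' n -> exists i, n + k = cut phi w i].
Proof.
move=> [[m0 occ_m0] [k cut_k]].
have [i0 def_c] := cut_k m0 occ_m0; set c := cut phi w i0 in def_c.
(* Smallest window of [w] holding both the occurrence at [m0] and the point [c], which may lie on
   either side of it. *)
pose b := minn m0 c; pose L := maxn (m0 + size u) c - b.
exists (slice w b L), (c - b); rewrite size_slice; split; first 2 last.
- move=> n; rewrite /occurs_at size_slice => occ_n.
  (* Each occurrence of the window contains [u] at the same relative place, hence a cutting point at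
     the same offset. *)
  have occ_u : occurs_at w u (n + (m0 - b)).
    rewrite /occurs_at (slice_slice occ_n); last lia.
    by rewrite subnKC ?geq_minl.
  have [i def_i] := cut_k _ occ_u; exists i; lia.
- by exists b; rewrite /occurs_at size_slice.
- lia.
Qed.

End Words.

Lemma prime_dvd_nonunit (d : int) :
  d <> 1%R -> d <> (-1)%R -> exists2 p, prime p & (d%:~R = 0 :> 'F_p)%R.
Proof.
move=> d1 dN1; have [p p_pr p_dvd] : exists2 p, prime p & p %| `|d|%N.
  (* Every prime divides 0, so 2 serves there; otherwise the absolute value exceeds 1. *)
  have [/eqP d0 | ] := boolP (`|d|%N == 0); first by exists 2; rewrite ?d0.
  by move=> dn0; have [|p] := @pdivP `|d|%N; [lia | exists p].
exists p => //; rewrite [d]intEsign rmorphM /= -pmulrn.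
suff -> : (`|d|%:R = 0 :> 'F_p)%R by rewrite mulr0.
by apply/eqP; rewrite -(dvdn_pcharf (pchar_Fp p_pr)).
Qed.

Theorem theorem7 (sigma : nat) (phi : 'I_sigma -> seq 'I_sigma)
    (w : nat -> 'I_sigma) :
  nonerasing phi ->
  generated_by phi w ->
  (\det (incidence_matrix phi) <> 1)%R ->
  (\det (incidence_matrix phi) <> -1)%R ->
  (exists u : seq 'I_sigma, cutting phi w u) ->
  ~ welldoc w.
Proof.
move=> _ gen_w det1 detN1 [u0 /cutting_extend[u [k [fac_u le_k cut_u]]]] wd_w.
have [p p_pr det0] := prime_dvd_nonunit det1 detN1.
have /det0P[v v_n0 vA0] : (\det (map_mx intr (incidence_matrix phi)) == 0 :> 'F_p)%R.
  by rewrite det_map_mx; apply/eqP.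
(* [v] kills the prefix of length [n + k], which is [slice w 0 n] followed by [take k u]; the value
   on the first part is thus independent of [n]. *)
pose c := (- (v *m parikh_ring 'F_p (take k u)))%R.
have v_const n : occurs_at w u n -> (v *m parikh_ring 'F_p (slice w 0 n) = c)%R.
  move=> occ_n; have [i def_i] := cut_u n occ_n.
  have take_u : take k u = slice w n k.
    by rewrite -occ_n -(subnKC le_k) slice_cat take_size_cat ?size_slice.
  apply/eqP; rewrite -addr_eq0 take_u -mulmxDr -parikh_ring_cat -slice_cat def_i.
  by rewrite generated_by_fixed // parikh_ring_extend mulmxA vA0 mul0mx.
have v_all (y : 'cV['F_p]_sigma) : (v *m y = c)%R.
  by have [n /v_const <- <-] := welldoc_Fp y p_pr wd_w fac_u.
(* The zero vector gives [c = 0]; unit vectors then show that each coordinate of [v] vanishes. *)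
have c0 : c = 0%R by rewrite -(v_all 0%R) mulmx0.
case/negP: v_n0; apply/eqP/rowP=> j.
by have /colP/(_ ord0) := v_all (delta_mx j ord0); rewrite -colE c0 !mxE.
Qed.
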